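(* Consider the Copas-like selection model with parameter vector $(\gamma_1,\gamma_2,\rho,\tau,\theta)$ described in the context. If $\rho\neq 0$, then the parameters $\gamma_1,\gamma_2,\rho,\tau$ and $\theta$ are all identifiable. That is, suppose $(\gamma_1,\gamma_2,\rho,\tau,\theta)$ and $(\tilde\gamma_1,\tilde\gamma_2,\tilde\rho,\tilde\tau,\tilde\theta)$ are two parameter vectors in the parameter space, the first with $\rho\neq0$, and $F,\tilde F$ are two absolutely continuous distributions on $(0,\infty)$ for the standard error. If the distribution of a published study $(\theta_i,s_i)$, i.e. the conditional distribution of $(\theta_i^*,s_i^* )$ given $Z_i>0$, is the same under $(\gamma_1,\gamma_2,\rho,\tau,\theta,F)$ and under $(\tilde\gamma_1,\tilde\gamma_2,\tilde\rho,\tilde\tau,\tilde\theta,\tilde F)$, then $(\gamma_1,\gamma_2,\rho,\tau,\theta)=(\tilde\gamma_1,\tilde\gamma_2,\tilde\rho,\tilde\tau,\tilde\theta)$.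
   Context: Copas-like selection model. For study $i$, $s_i^*>0$ is a random standard error with unknown distribution $F$ on $(0,\infty)$, treated nonparametrically and having a density. Given $s_i^*$, the effect estimate is $\theta_i^*=\theta+\tau u_i+s_i^*\epsilon_i$, and the latent selection variable is $Z_i=\gamma_1+\gamma_2/s_i^*+\delta_i$. Here $u_i\sim N(0,1)$; $(\epsilon_i,\delta_i)$ is bivariate normal with zero means, unit variances and correlation $\rho$; $u_i$ is independent of $(\epsilon_i,\delta_i)$; and $(u_i,\epsilon_i,\delta_i)$ is independent of $s_i^*$. Study $i$ is published (observed) if and only if $Z_i>0$; a published study $(\theta_i,s_i)$ has the conditional distribution of $(\theta_i^*,s_i^* )$ given $Z_i>0$. Parameter space: $\gamma_1,\gamma_2,\theta\in\mathbb{R}$, $\tau\ge0$, $\rho\in(-1,1)$. *)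

(* Defs.v *)
From HB Require Import structures.
From mathcomp Require Import all_boot all_order all_algebra.
From mathcomp Require Import all_classical all_reals all_analysis.

Set Implicit Arguments.
Unset Strict Implicit.
Unset Printing Implicit Defensive.

Import Order.TTheory GRing.Theory Num.Theory.
Import numFieldNormedType.Exports.

Local Open Scope classical_set_scope.
Local Open Scope ring_scope.

(* Laws are compared on measurable sets only: measures are total functions on
   all sets, and their values elsewhere carry no meaning. *)
Definition has_law d d' (T : measurableType d) (T' : measurableType d')
    (R : realType) (P : probability T R) (X : {RV P >-> T'})
    (mu : set T' -> \bar R) : Prop :=
  forall A : set T', measurable A -> distribution P X A = mu A.

Definition independent_RVs d d1 d2 (T : measurableType d)
    (T1 : measurableType d1) (T2 : measurableType d2) (R : realType)
    (P : probability T R) (X : T -> T1) (Y : T -> T2) : Prop :=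
  forall (A : set T1) (B : set T2), measurable A -> measurable B ->
    (P (X @^-1` A `&` Y @^-1` B) = P (X @^-1` A) * P (Y @^-1` B))%E.

Definition cond_prob d (T : measurableType d) (R : realType)
    (P : probability T R) (A B : set T) : R :=
  fine (P (A `&` B)) / fine (P B).

(* Zero means, unit variances, correlation rho; meaningful for |rho| < 1. *)
Definition binormal_pdf (R : realType) (rho : R) (z : R * R) : R :=
  (2 * pi * Num.sqrt (1 - rho ^+ 2))^-1 *
  expR (- (z.1 ^+ 2 - 2 * rho * z.1 * z.2 + z.2 ^+ 2) /
          (2 * (1 - rho ^+ 2))).

Definition binormal_prob (R : realType) (rho : R) (V : set (R * R)) : \bar R :=
  (\int[(@lebesgue_measure R \x @lebesgue_measure R)%E]_(z in V)
     (binormal_pdf rho z)%:E)%E.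

Record copas_param (R : Type) := CopasParam {
  gamma1 : R;
  gamma2 : R;
  rho : R;
  tau : R;
  theta : R
}.

Definition copas_space (R : realType) (p : copas_param R) : Prop :=
  [/\ 0 <= tau p, -1 < rho p & rho p < 1].

(* By Radon-Nikodym, domination by Lebesgue measure means having a density. *)
Definition abs_cont_on_pos (R : realType)
    (F : probability (measurableTypeR R) R) : Prop :=
  F (`]0, +oo[)%classic = 1%E /\ F `<< @lebesgue_measure R.

Section model.
Context d (T : measurableType d) (R : realType) (P : probability T R).
Variables (p : copas_param R) (s u eps del : {RV P >-> measurableTypeR R}).

Definition copas_model (F : probability (measurableTypeR R) R) : Prop :=
  [/\ has_law s F,
      has_law u (normal_prob 0 1),
      forall A : set (measurableTypeR R * measurableTypeR R), measurable A ->
        P [set t | A (eps t, del t)] = binormal_prob (rho p) A,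
      independent_RVs P u (fun t => (eps t, del t)) &
      independent_RVs P (fun t => (u t, eps t, del t)) s].

(* theta*: effect estimate of a study before selection. *)
Definition copas_effect (t : T) : R := theta p + tau p * u t + s t * eps t.

(* Z; the set s <= 0, where the quotient may be junk, is P-null in the model. *)
Definition copas_latent (t : T) : R := gamma1 p + gamma2 p / s t + del t.

(* Law of the pair (effect, standard error) given Z > 0. *)
Definition published_law (A : set (R * R)) : R :=
  cond_prob P [set t | A (copas_effect t, s t)] [set t | 0 < copas_latent t].

End model.

(* Main.v *)
Require Import Defs.
From HB Require Import structures.
From mathcomp Require Import all_boot all_order all_algebra.
From mathcomp Require Import all_classical all_reals all_analysis.
From mathcomp Require Import measurable_realfun.
From mathcomp Require Import ring lra.

Set Implicit Arguments.
Unset Strict Implicit.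
Unset Printing Implicit Defensive.

Import Order.TTheory GRing.Theory Num.Theory.
Import numFieldNormedType.Exports.

Local Open Scope classical_set_scope.
Local Open Scope ring_scope.

(* Tilting a study by e^(t * effect) on the event Z > 0 gives, conditionally on s, an
   explicit Gaussian integral: up to a normalising constant the transform is
   e^(t theta + t^2 (tau^2 + s^2) / 2) Phi(gamma1 + gamma2 / s + t rho s).
   The unknown laws F, F' cancel after cross-multiplying by the value at t = 0,
   so for F-almost every s the transforms of the two models agree at all
   integers t. On the side t -> +-oo where t rho > 0 the factor Phi tends to 1,
   on the other side it decays like e^(- t^2 rho^2 s^2 / 2); comparing both
   sides forces rho and rho' to have the same sign, then yields theta,
   tau^2 + s^2, gamma1 + gamma2 / s and rho s. Since F has no atoms there are two
   such values of s, which separate gamma1 from gamma2. *)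

(** * Identification of a tilted transform from its values at the integers *)

Lemma quadratic_ub (R : realType) (a b c : R) :
  (forall n : nat, a * n%:R ^+ 2 + b * n%:R <= c) ->
  a <= 0 /\ (a = 0 -> b <= 0).
Proof.
move=> H.
have lin (x k : R) : (forall n : nat, (0 < n)%N -> x * n%:R <= k) -> x <= 0.
  move=> Hx; rewrite leNgt; apply/negP => x0.
  have := truncnS_gt (k / x); rewrite ltr_pdivrMr// mulrC.
  by rewrite ltNge Hx.
split.
(* Dividing by n >= 1 gives a n <= c / n - b, which is at most [|c| + |b|]; this reduces to the
   linear case. *)
- apply: (lin _ (`|c| + `|b|)).
  move=> n n0; have n1 : 1 <= n%:R :> R by rewrite ler1n.
  have hn := H n.
  rewrite -(@ler_pM2r _ n%:R); last by lra.
  have h1 := ler_norm c; have h2 := ler_norm (- b).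
  have h3 := normr_ge0 c; rewrite normrN in h2.
  have h4 : 0 <= (n%:R - 1) * `|c| by apply: mulr_ge0; lra.
  have h5 : 0 <= n%:R * (`|b| + b) by apply: mulr_ge0; lra.
  nra.
- by move=> a0; apply: (lin _ c) => n n0; have := H n; rewrite a0 mul0r add0r.
Qed.

Section tilt.
Context (R : realType) (Phi : R -> R).
Hypothesis Phi_gt0 : forall x, 0 < Phi x.
Hypothesis Phi_le1 : forall x, Phi x <= 1.
Hypothesis Phi_inc : {homo Phi : x y / x < y}.
Hypothesis Phi_lim : forall c r : R, 0 < r -> Phi (c + n%:R * r) @[n --> \oo] --> (1 : R).
Hypothesis Phi_tail : forall k x : R, 0 <= k -> Phi x <= expR (k ^+ 2 / 2 + k * x).

Let Phi_ndec x y : x <= y -> Phi x <= Phi y.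
Proof. exact: (ltW_homo Phi_inc). Qed.

Let Phi_inj : injective Phi.
Proof.
move=> x y xy; apply/eqP; rewrite eq_le !leNgt.
by apply/andP; split; apply/negP => /Phi_inc; rewrite xy ltxx.
Qed.

(** One side of the cross-multiplied identity: the Gaussian transform with mean m and variance v,
    its selection factor, and the other model's selection factor [Phi c'] at t = 0. [Phi] stands for
    the normal distribution function, of which only the section hypotheses are kept. *)
Definition tilt (m v c r c' t : R) : R :=
  expR (t * m + t ^+ 2 * v / 2) * Phi (c + t * r) * Phi c'.

(** For r > 0 the factor [Phi (c + n r)] stays above [Phi c], while the factors on the right are at
    most 1. Taking logarithms bounds n (m - m') + n^2 (v - v') / 2 by a constant, and [quadratic_ub]
    applies. *)
Lemma tilt_quadratic_le m v c r c' m' v' r' : 0 < r ->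
  (forall n : nat, tilt m v c r c' n%:R = tilt m' v' c' r' c n%:R) ->
  v <= v' /\ (v = v' -> m <= m').
Proof.
move=> r0 H.
have [|h1 h2] := @quadratic_ub R ((v - v') / 2) (m - m') (- ln (Phi c * Phi c')).
  move=> n; have P0 : 0 < Phi c * Phi c' by rewrite mulr_gt0.
  rewrite -lerN2 opprK -ler_expR lnK ?posrE//.
  have : expR (n%:R * m + n%:R ^+ 2 * v / 2) * (Phi c * Phi c') <=
         expR (n%:R * m' + n%:R ^+ 2 * v' / 2).
    apply: (@le_trans _ _ (tilt m v c r c' n%:R)).
      rewrite /tilt mulrA ler_pM2r// ler_pM2l ?expR_gt0// Phi_ndec//.
      by rewrite lerDl mulr_ge0// ltW.
    rewrite H /tilt -mulrA ler_piMr ?expR_ge0//.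
    by rewrite mulr_ile1// ltW.
  rewrite -ler_pdivlMl ?expR_gt0// -expRN -expRD => /le_trans; apply.
  by rewrite ler_expR; lra.
split; first lra.
by move=> vv; move: h2; rewrite vv subrr mul0r => /(_ erefl); lra.
Qed.

(** If r' > 0, the growth comparison runs both ways and the exponentials cancel, leaving an identity
    between values of [Phi]. If r' <= 0, the behaviour at negative integers is contradictory. *)
Lemma tilt_identifiable_pos m v c r m' v' c' r' : 0 < r ->
  (forall n : nat, tilt m v c r c' n%:R = tilt m' v' c' r' c n%:R /\
                   tilt m v c r c' (- n%:R) = tilt m' v' c' r' c (- n%:R)) ->
  [/\ m = m', v = v', c = c' & r = r'].
Proof.
move=> r0 H.
have Hp n := (H n).1; have Hn n := (H n).2 => {H}.
have [vv' mm'] := tilt_quadratic_le r0 Hp.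
have [r'0|r'0] := ltP 0 r'.
  have [v'v m'm] := tilt_quadratic_le r'0 (fun n => esym (Hp n)).
  have ve : v = v' by apply/eqP; rewrite eq_le vv'.
  have me : m = m' by apply/eqP; rewrite eq_le mm'// m'm.
  subst v' m'.
  have E n : Phi (c + n%:R * r) * Phi c' = Phi (c' + n%:R * r') * Phi c.
    have := Hp n; rewrite /tilt -!mulrA; apply: mulfI.
    by rewrite gt_eqF// expR_gt0.
  (* Both sides of [E] converge, since [Phi] tends to 1 along each progression; the limits are
     [Phi c'] and [Phi c]. *)
  have ce : c = c'.
    have L1 : Phi (c + n%:R * r) * Phi c' @[n --> \oo] --> 1 * Phi c'.
      by apply: cvgM; [exact: Phi_lim|exact: cvg_cst].
    have L2 : Phi (c + n%:R * r) * Phi c' @[n --> \oo] --> 1 * Phi c.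
      under eq_fun do rewrite E.
      by apply: cvgM; [exact: Phi_lim|exact: cvg_cst].
    apply: Phi_inj; rewrite -[LHS]mul1r -[RHS]mul1r.
    by apply: (cvg_unique _ L2 L1); exact: norm_hausdorff.
  subst c'; split=> //.
  have := E 1%N; rewrite !mul1r => /mulIf.
  by rewrite gt_eqF// => /(_ isT) /Phi_inj /addrI.
exfalso.
(* As t -> -oo the factor Phi (c + t r) is Gaussian small, which forces
   v' <= v - r^2 and contradicts v <= v'. *)
have [|h1 _] := @quadratic_ub R ((v' - (v - r ^+ 2)) / 2) (m - m' - r * c)
    (- ln (Phi c * Phi c')).
  move=> n; have P0 : 0 < Phi c * Phi c' by rewrite mulr_gt0.
  rewrite -lerN2 opprK -ler_expR lnK ?posrE//.
  have : expR (- n%:R * m' + (- n%:R) ^+ 2 * v' / 2) * (Phi c * Phi c') <=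
         expR (- n%:R * m + (- n%:R) ^+ 2 * v / 2) *
         expR ((n%:R * r) ^+ 2 / 2 + (n%:R * r) * (c + - n%:R * r)).
    apply: (@le_trans _ _ (tilt m' v' c' r' c (- n%:R))).
      rewrite /tilt (mulrC (Phi c)) mulrA ler_pM2r// ler_pM2l ?expR_gt0//.
      by rewrite Phi_ndec// lerDl mulNr oppr_ge0 mulr_ge0_le0.
    rewrite -Hn /tilt -mulrA ler_pM2l ?expR_gt0//.
    apply: (@le_trans _ _ (Phi (c + - n%:R * r))).
      by rewrite ler_piMr// ltW.
    (* The choice k = n r gives the exponent - n^2 r^2 / 2 + n r c, hence the loss of r^2 in the
       quadratic coefficient. *)
    by apply: Phi_tail; rewrite mulr_ge0// ltW.
  rewrite -expRD -ler_pdivlMl ?expR_gt0// -expRN -expRD => /le_trans; apply.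
  by rewrite ler_expR; lra.
have : 0 < r ^+ 2 by rewrite exprn_gt0.
lra.
Qed.

(** Replacing t by -t flips the signs of m and r only, so the case r < 0 reduces to r > 0. *)
Lemma tilt_identifiable m v c r m' v' c' r' : r != 0 ->
  (forall n : nat, tilt m v c r c' n%:R = tilt m' v' c' r' c n%:R /\
                   tilt m v c r c' (- n%:R) = tilt m' v' c' r' c (- n%:R)) ->
  [/\ m = m', v = v', c = c' & r = r'].
Proof.
have tiltN a b x y z t : tilt (- a) b x (- y) z t = tilt a b x y z (- t).
  by rewrite /tilt sqrrN !mulrN !mulNr.
move=> /lt_total /orP[r0 H|]; last exact: tilt_identifiable_pos.
have [||/oppr_inj -> -> -> /oppr_inj ->//] :=
  @tilt_identifiable_pos (- m) v c (- r) (- m') v' c' (- r').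
- by rewrite oppr_gt0.
- by move=> n; rewrite !tiltN opprK; have [] := H n.
Qed.

End tilt.

(** * Shift, tail bound, monotonicity and limit of the standard normal tail *)

Section normal.
Context {R : realType}.
Notation mu := (@lebesgue_measure R).

Let shift_measurable (a : R) :
  measurable_fun setT (fun x : measurableTypeR R => x + a : measurableTypeR R).
Proof. exact: measurable_funD. Qed.

Let shift_mfun (a : R) : {mfun measurableTypeR R >-> measurableTypeR R} :=
  HB.pack (fun x : measurableTypeR R => x + a : measurableTypeR R)
    (isMeasurableFun.Build _ _ _ _ _ (shift_measurable a)).

Lemma lebesgue_measure_shift (a : R) (A : set R) : measurable A ->
  pushforward mu (shift_mfun a) A = mu A.
Proof.
move=> mA; apply/esym.
apply: (lebesgue_measure_unique (mu := pushforward mu (shift_mfun a))) => //.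
move=> _ [[x y]] _ <-.
rewrite /pushforward /= [X in _ = mu X](_ : _ = `]x - a, y - a]%classic).
  by rewrite !lebesgue_measure_itv/= !lte_fin ltrD2r -!EFinB opprB addrA subrK.
by apply/seteqP; split => z /=; rewrite !in_itv/= ltrBlDr lerBrDr.
Qed.

Lemma normal_prob_shift (m s x : R) : s != 0 ->
  normal_prob m s `]x, +oo[ = normal_prob 0 s `]x - m, +oo[.
Proof.
move=> s0; rewrite /normal_prob.
transitivity (\int[pushforward mu (shift_mfun m)]_(y in `]x, +oo[) (normal_pdf m s y)%:E)%E.
  by apply: eq_measure_integral => A mA _; exact/esym/lebesgue_measure_shift.
rewrite ge0_integral_pushforward//; last 2 first.
- apply/measurable_funTS/measurable_EFinP; exact: measurable_normal_pdf.
- by move=> y _; rewrite lee_fin normal_pdf_ge0.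
rewrite (_ : _ @^-1` _ = `]x - m, +oo[%classic); last first.
  by apply/seteqP; split => z /=; rewrite !in_itv/= !andbT ltrBlDr.
apply: eq_integral => y _ /=.
by rewrite !normal_pdfE// /normal_fun addrK subr0.
Qed.

(* The standard normal distribution function, written as an upper tail. *)
Definition normal_tail (x : R) : R := fine (normal_prob 0 1 `](- x), +oo[).

Lemma normal_tailE x : normal_prob 0 1 `](- x), +oo[ = (normal_tail x)%:E.
Proof. by rewrite fineK// fin_num_measure. Qed.

Lemma normal_tail_le1 x : normal_tail x <= 1.
Proof. by rewrite -lee_fin -normal_tailE probability_le1. Qed.

(** On y > -x the factor e^(k (x + y)) is at least 1. Multiplied by it, the standard density becomes
    e^(k^2 / 2 + k x) times the density of mean k, whose total mass is 1. *)
Lemma normal_tail_chernoff (k x : R) : 0 <= k ->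
  normal_tail x <= expR (k ^+ 2 / 2 + k * x).
Proof.
move=> k0; rewrite -lee_fin -normal_tailE /normal_prob.
set e := expR _.
apply: (@le_trans _ _ (\int[mu]_(y in `](- x)%R, +oo[) (e * normal_pdf k 1 y)%:E)%E).
  apply: ge0_le_integral => //=.
  - by move=> y _; rewrite lee_fin normal_pdf_ge0.
  - by apply/measurable_funTS/measurable_EFinP; exact: measurable_normal_pdf.
  - apply/measurable_funTS/measurable_EFinP/measurable_funM => //.
    exact: measurable_normal_pdf.
  - move=> y; rewrite in_itv/= andbT => xy; rewrite lee_fin !normal_pdfE//=.
    rewrite mulrCA ler_pM2l ?normal_peak_gt0// /normal_fun /e -expRD ler_expR.
    have : 0 <= k * (y + x) by apply: mulr_ge0; lra.
    by rewrite expr1n; lra.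
under eq_integral do rewrite EFinM.
rewrite ge0_integralZl//=; last 3 first.
- by apply/measurable_funTS/measurable_EFinP; exact: measurable_normal_pdf.
- by move=> y _; rewrite lee_fin normal_pdf_ge0.
- by rewrite lee_fin expR_ge0.
have := @probability_le1 _ _ _ (normal_prob k 1) `](- x), +oo[%classic.
by move/(_ (measurable_itv _)) => h; rewrite -[leRHS]mule1 lee_pmul2l// lte_fin expR_gt0.
Qed.

Lemma normal_prob_itv_gt0 (x y : R) : x < y -> (0 < normal_prob 0 1 `]x, y])%E.
Proof.
(* For z between x and y one has z^2 <= x^2 + y^2 whatever the signs, so b is a positive lower bound
   of the density there. *)
move=> xy; pose b := normal_peak 1 * expR (- (x ^+ 2 + y ^+ 2) / 2).
have b0 : 0 < b :> R by rewrite mulr_gt0 ?expR_gt0// normal_peak_gt0.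
apply: (@lt_le_trans _ _ (\int[mu]_(z in `]x, y]) b%:E)%E).
  rewrite integral_cst//= lebesgue_measure_itv/= lte_fin xy -EFinB -EFinM lte_fin.
  by rewrite mulr_gt0// subr_gt0.
apply: ge0_le_integral => //=.
- by move=> z _; rewrite lee_fin ltW.
- by apply/measurable_funTS/measurable_EFinP; exact: measurable_normal_pdf.
- move=> z; rewrite in_itv/= => /andP[xz zy]; rewrite lee_fin normal_pdfE//=.
  rewrite ler_pM2l ?normal_peak_gt0// /normal_fun ler_expR expr1n subr0.
  have : 0 <= (z - x) * (y - z) by apply: mulr_ge0; lra.
  have := sqr_ge0 (x + y - z); lra.
Qed.

Lemma normal_tail_inc : {homo normal_tail : x y / x < y}.
Proof.
move=> x y xy; rewrite -lte_fin -!normal_tailE.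
have -> : `](- y), +oo[%classic = `](- y), (- x)] `|` `](- x), +oo[%classic.
  by rewrite -itv_bndbnd_setU// bnd_simp lerN2 ltW.
rewrite measureU//; last first.
  apply/seteqP; split => // z /= []; rewrite !in_itv/= andbT => /andP[_ h1 h2].
  by have := lt_le_trans h2 h1; rewrite ltxx.
by rewrite lteDr ?fin_num_measure// normal_prob_itv_gt0// ltrN2.
Qed.

Lemma normal_tail_gt0 x : 0 < normal_tail x.
Proof.
apply: (@le_lt_trans _ _ (normal_tail (x - 1))); last first.
  by apply: normal_tail_inc; rewrite ltrBlDr ltrDl.
by rewrite fine_ge0.
Qed.

Lemma normal_tail_cvg1 (c r : R) : 0 < r ->
  normal_tail (c + n%:R * r) @[n --> \oo] --> (1 : R).
Proof.
move=> r0.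
have mid : measurable_fun setT (fun x : measurableTypeR R => x : R) by [].
(* The identity is a standard normal variable under [normal_prob 0 1], and [normal_tail x] is its
   complementary distribution function at -x. *)
pose X : {RV normal_prob (0 : R) 1 >-> R} :=
  HB.pack (fun x : measurableTypeR R => x : R)
    (isMeasurableFun.Build _ _ _ _ _ mid).
have /fine_cvgP[_ //] : ccdf X (- (c + n%:R * r)) @[n --> \oo] --> 1%:E.
apply: (cvg_comp (fun n : nat => - (c + n%:R * r)) (ccdf X)); last exact: cvg_ccdfNy1.
apply/cvgrNyPle => A; near=> n.
have : (- A - c) / r <= n%:R by near: n; exact: nbhs_infty_ger.
by rewrite ler_pdivrMr//; lra.
Unshelve. all: by end_near.
Qed.

Lemma measurable_normal_tail : measurable_fun setT normal_tail.
Proof.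
apply: nondecreasing_measurable => // x y; exact: (ltW_homo normal_tail_inc).
Qed.

End normal.

(** The function g has the same integrals over measurable sets as the Radon-Nikodym derivative of
    nu, so the two agree almost everywhere and the change of variables applies. *)
Lemma ge0_integral_density d (T : measurableType d) (R : realType)
    (nu : {finite_measure set T -> \bar R})
    (mu : {sigma_finite_measure set T -> \bar R}) (g : T -> R) (f : T -> \bar R) :
  measurable_fun setT g -> (forall x, 0 <= g x) ->
  (forall A, measurable A -> nu A = (\int[mu]_(x in A) (g x)%:E)%E) ->
  measurable_fun setT f -> (forall x, (0 <= f x)%E) ->
  (\int[nu]_x f x = \int[mu]_x (f x * (g x)%:E))%E.
Proof.
move=> mg g0 nuE mf f0.
have mgE : measurable_fun setT (EFin \o g) by exact/measurable_EFinP.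
have numu : nu `<< mu.
  apply/null_content_dominatesP => A mA muA0; rewrite nuE//.
  by apply: null_set_integral => //; exact: measurable_funTS.
rewrite -(Radon_Nikodym_SigmaFinite.change_of_variables numu)//.
have ih := Radon_Nikodym_SigmaFinite.f_integrable numu.
apply: ae_eq_integral => //.
- by apply: emeasurable_funM => //; exact: measurable_int ih.
- exact: emeasurable_funM.
apply: ae_eqe_mul2l; apply: integral_ae_eq => //= E _ mE.
by rewrite -nuE// -Radon_Nikodym_SigmaFinite.f_integral.
Qed.

(** * Exponential tilting of univariate and bivariate normal laws *)

Section gaussian_tilting.
Context {R : realType}.
Notation mu := (@lebesgue_measure R).

Let lebesgue2_sigma_finite : sigma_finite setT (mu \x mu)%E.
Proof.
pose I n : set (measurableTypeR R) := `[- n%:R, n%:R]%classic.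
have Ioo n : (mu (I n) < +oo)%E.
  by rewrite /I lebesgue_measure_itv/=; case: ifP => _; rewrite ?ltry.
exists (fun n => I n `*` I n); last first.
  move=> n; split; first by apply: measurableX; exact: measurable_itv.
  rewrite product_measure1E//=; try exact: measurable_itv. by rewrite lte_mul_pinfty// ge0_fin_numE.
apply/esym; rewrite -subTset => -[x y] _.
exists (Num.truncn (`|x| + `|y|)).+1 => //.
have := truncnS_gt (`|x| + `|y|); move: (normr_ge0 x) (normr_ge0 y) => hx hy h.
by split; rewrite /I /= in_itv/= -ler_norml; lra.
Qed.

(* The instance search only knows products of subprobabilities as sigma-finite. *)
Let lebesgue2 : {sigma_finite_measure set (measurableTypeR R * measurableTypeR R)%type -> \bar R} :=
  HB.pack (mu \x mu)%E (Measure_isSigmaFinite.Build _ _ _ _ lebesgue2_sigma_finite).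

(** Completing the square in the exponent. *)
Lemma expR_normal_pdf (a m s x : R) : s != 0 ->
  expR (a * x) * normal_pdf m s x =
  expR (a * m + a ^+ 2 * s ^+ 2 / 2) * normal_pdf (m + a * s ^+ 2) s x.
Proof.
move=> s0; rewrite !normal_pdfE// mulrCA [RHS]mulrCA; congr (_ * _).
by rewrite /normal_fun -!expRD; congr expR; field.
Qed.

Lemma normal_prob_mgf (a : R) (P : probability (measurableTypeR R) R) :
  (forall A, measurable A -> P A = normal_prob 0 1 A) ->
  (\int[P]_x (expR (a * x))%:E = (expR (a ^+ 2 / 2))%:E)%E.
Proof.
move=> PE.
rewrite (ge0_integral_density (mu := mu) (measurable_normal_pdf 0 1)
  (normal_pdf_ge0 0 1) PE); last 2 first.
- by apply/measurable_EFinP/measurableT_comp => //; exact: measurable_funM.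
- by move=> x; rewrite lee_fin expR_ge0.
under eq_integral.
  move=> x _; rewrite -EFinM expR_normal_pdf// EFinM; over.
rewrite ge0_integralZl//=; last 2 first.
- by apply/measurable_EFinP; exact: measurable_normal_pdf.
- by move=> x _; rewrite lee_fin normal_pdf_ge0.
by rewrite integral_normal_pdf mule1 mulr0 add0r expr1n mulr1.
Qed.

(** Disintegration along the second component, on which selection acts, so that the first can be
    integrated out before it. *)
Lemma binormal_pdfE (rho x y : R) : -1 < rho -> rho < 1 ->
  binormal_pdf rho (x, y) =
  normal_pdf 0 1 y * normal_pdf (rho * y) (Num.sqrt (1 - rho ^+ 2)) x.
Proof.
move=> h1 h2; have r0 : 0 < 1 - rho ^+ 2 by nra.
have s0 : Num.sqrt (1 - rho ^+ 2) != 0 by rewrite gt_eqF// sqrtr_gt0.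
have pi0 := pi_gt0 R.
rewrite !normal_pdfE// mulrACA /binormal_pdf /normal_fun -expRD/=.
rewrite /normal_peak sqr_sqrtr ?ltW//; congr (_ * expR _).
  rewrite -invfM expr1n mul1r -mulrnAr sqrtrM ?ltW// mulrCA -expr2 sqr_sqrtr; last lra.
  by rewrite mulrC mulr2n; congr (_^-1); ring.
by field; rewrite gt_eqF.
Qed.

Lemma binormal_pdf_ge0 (rho : R) z : 0 <= binormal_pdf rho z.
Proof.
by rewrite /binormal_pdf mulr_ge0 ?expR_ge0// invr_ge0 !mulr_ge0// pi_ge0.
Qed.

Lemma measurable_binormal_pdf (rho : R) :
  measurable_fun setT (binormal_pdf rho : measurableTypeR R * measurableTypeR R -> R).
Proof.
apply: measurable_funM => //; apply: measurableT_comp => //.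
apply: measurable_funM => //; apply: measurableT_comp => //.
apply: measurable_funD; last exact: measurable_funX.
apply: measurable_funB; first exact: measurable_funX.
by apply: measurable_funM => //; exact: measurable_funM.
Qed.

(* The event [Z > 0], with [c = gamma1 + gamma2 / s] and [y = delta]. *)
Definition selected (c y : R) : R := \1_`]0, +oo[%classic (c + y).

Lemma measurable_selected d (T : measurableType d) (f g : T -> R) :
  measurable_fun setT f -> measurable_fun setT g ->
  measurable_fun setT (fun x => selected (f x) (g x)).
Proof.
move=> mf mg; rewrite /selected.
by apply: measurableT_comp (measurable_funD mf mg); exact: measurable_indic.
Qed.

(* Exponentially tilting the pair shifts the mean of its second component by
   rho * r, and leaves a normal first component that integrates to one. *)
Lemma binormal_mgf (rho r c : R)
    (P : probability (measurableTypeR R * measurableTypeR R)%type R) :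
  -1 < rho -> rho < 1 ->
  (forall A, measurable A -> P A = binormal_prob rho A) ->
  (\int[P]_z (expR (r * z.1) * selected c z.2)%:E =
   (expR (r ^+ 2 / 2) * normal_tail (c + rho * r))%:E)%E.
Proof.
move=> h1 h2 PE; set s := Num.sqrt (1 - rho ^+ 2).
have r0 : 0 < 1 - rho ^+ 2 by nra.
have s0 : s != 0 by rewrite gt_eqF// sqrtr_gt0.
have s2 : s ^+ 2 = 1 - rho ^+ 2 by rewrite sqr_sqrtr// ltW.
have mr : measurable_fun setT (fun z : measurableTypeR R * measurableTypeR R => selected c z.2).
  exact: measurable_selected.
have mf : measurable_fun setT (fun z : measurableTypeR R * measurableTypeR R =>
    expR (r * z.1) * selected c z.2).
  apply: measurable_funM => //; apply: measurableT_comp => //.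
  exact: measurable_funM.
have mb := measurable_binormal_pdf rho.
rewrite (@ge0_integral_density _ (measurableTypeR R * measurableTypeR R)%type R
  P lebesgue2 _ _ mb (binormal_pdf_ge0 rho) PE); last 2 first.
- exact/measurable_EFinP.
- by move=> x; rewrite lee_fin mulr_ge0 ?expR_ge0.
rewrite fubini_tonelli2//; last 2 first.
- by apply/emeasurable_funM; exact/measurable_EFinP.
- by move=> x; rewrite mule_ge0 ?lee_fin ?binormal_pdf_ge0// mulr_ge0 ?expR_ge0.
have inner y : fubini_G mu (fun z => ((expR (r * z.1) * selected c z.2)%:E *
    (binormal_pdf rho z)%:E)%E) y =
    ((expR (r ^+ 2 / 2))%:E * ((normal_pdf (r * rho) 1) \_ `](- c)%R, +oo[ y)%:E)%E.
  transitivity (\int[mu]_x ((selected c y * expR (r ^+ 2 / 2) * normal_pdf (r * rho) 1 y)%:E *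
      (normal_pdf (rho * y + r * s ^+ 2) s x)%:E))%E.
    apply: eq_integral => x _; rewrite -!EFinM; congr EFin.
    rewrite binormal_pdfE// -/s.
    have e1 := expR_normal_pdf r (rho * y) x s0.
    have e2 := @expR_normal_pdf (r * rho) 0 1 y (oner_neq0 _).
    (* The quadratic terms recombine because s^2 + rho^2 = 1. *)
    have e3 : expR (r * (rho * y) + r ^+ 2 * s ^+ 2 / 2) * expR ((r * rho) ^+ 2 / 2) =
        expR (r ^+ 2 / 2) * expR (r * rho * y).
      by rewrite -!expRD s2; congr expR; field.
    transitivity (selected c y * normal_pdf 0 1 y *
        (expR (r * x) * normal_pdf (rho * y) s x)); first ring.
    rewrite e1.
    (* This nonzero factor, put on both sides, lets [e2] tilt the marginal density of y without
       introducing an inverse. *)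
    apply: (@mulfI _ (expR (r * rho * y))); first by rewrite gt_eqF// expR_gt0.
    transitivity (selected c y * (expR (r * rho * y) * normal_pdf 0 1 y) *
        (expR (r * (rho * y) + r ^+ 2 * s ^+ 2 / 2) *
         normal_pdf (rho * y + r * s ^+ 2) s x)); first ring.
    rewrite e2 mulr0 add0r expr1n !mulr1 add0r.
    transitivity (selected c y * normal_pdf (r * rho) 1 y *
        (expR (r * (rho * y) + r ^+ 2 * s ^+ 2 / 2) * expR ((r * rho) ^+ 2 / 2)) *
         normal_pdf (rho * y + r * s ^+ 2) s x); first ring.
    by rewrite e3; ring.
  rewrite ge0_integralZl//=; last 3 first.
  - by apply/measurable_EFinP; exact: measurable_normal_pdf.
  - by move=> x _; rewrite lee_fin normal_pdf_ge0.
  - by rewrite lee_fin !mulr_ge0 ?expR_ge0 ?normal_pdf_ge0.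
  rewrite integral_normal_pdf mule1 -EFinM; congr EFin.
  rewrite patchE /selected indicE !mem_setE !in_itv/= !andbT.
  have -> : (- c < y) = (0 < c + y) by rewrite -subr_gt0 opprK addrC.
  by case: ifP => _; rewrite ?mulr0 ?mul0r// mul1r.
transitivity (\int[mu]_y ((expR (r ^+ 2 / 2))%:E *
    ((normal_pdf (r * rho) 1) \_ `](- c)%R, +oo[ y)%:E))%E.
  by apply: eq_integral => y _; exact: inner.
rewrite ge0_integralZl//=; last 2 first.
- apply/measurable_EFinP/(measurable_restrictT _ _).1; first exact: measurable_itv.
  by apply: measurable_funTS; exact: measurable_normal_pdf.
- by move=> x _; rewrite lee_fin patchE; case: ifP => // _; exact: normal_pdf_ge0.
rewrite EFinM -normal_tailE; congr (_ * _)%E.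
rewrite (_ : - (c + rho * r) = - c - r * rho); last by ring.
rewrite -normal_prob_shift// /normal_prob [RHS]integral_mkcond.
by apply: eq_integral => x _; rewrite restrict_EFin.
Qed.

End gaussian_tilting.

(** * Independence, restricted laws and elimination of unknown measures *)

(** The inverse of x is x times a real power of the nonnegative x^2; at x = 0 both vanish by the
    convention 1 / 0 = 0. *)
Lemma measurable_inv_fun d (T : measurableType d) (R : realType) (f : T -> R) :
  measurable_fun setT f -> measurable_fun setT (fun x => (f x)^-1).
Proof.
move=> mf.
have fE : (fun x => (f x)^-1) = (fun x => f x * (f x ^+ 2) `^ (-1)).
  apply/funext => x; rewrite powR_inv1 ?sqr_ge0//.
  have [->|fx0] := eqVneq (f x) 0; first by rewrite invr0 mul0r.
  by rewrite expr2 invfM mulrA mulfV// mul1r.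
rewrite fE; apply: measurable_funM => //.
apply: (@measurableT_comp _ _ _ _ _ _ (fun x : R => x `^ (-1))).
  exact: measurable_powR.
exact: measurable_funX.
Qed.

(** Independence fixes the joint law on rectangles, so it is the product of the marginal laws, and
    Tonelli applies. With Y outermost, the inner integral plays the role of conditioning on Y. *)
Lemma independent_integral d d1 d2 (T : measurableType d) (T1 : measurableType d1)
    (T2 : measurableType d2) (R : realType) (P : probability T R)
    (X : T -> T1) (Y : T -> T2) (f : T1 * T2 -> \bar R) :
  measurable_fun setT X -> measurable_fun setT Y -> independent_RVs P X Y ->
  measurable_fun setT f -> (forall z, (0 <= f z)%E) ->
  (\int[P]_t f (X t, Y t) = \int[P]_t \int[P]_t' f (X t', Y t))%E.
Proof.
move=> mX mY XY mf f0.
pose X' : {mfun T >-> T1} := HB.pack X (isMeasurableFun.Build _ _ _ _ _ mX).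
pose Y' : {mfun T >-> T2} := HB.pack Y (isMeasurableFun.Build _ _ _ _ _ mY).
have mXY : measurable_fun setT (fun t => (X t, Y t)) by exact: measurable_fun_pair.
pose XY' : {mfun T >-> (T1 * T2)%type} :=
  HB.pack (fun t => (X t, Y t)) (isMeasurableFun.Build _ _ _ _ _ mXY).
transitivity (\int[distribution P XY']_z f z)%E.
  by rewrite ge0_integral_distribution.
transitivity (\int[(distribution P X' \x distribution P Y')%E]_z f z)%E.
  apply: eq_measure_integral => A mA _.
  apply/esym; apply: (@product_measure_unique _ _ _ _ _ (distribution P X')
    (distribution P Y') (distribution P XY')) => //.
rewrite fubini_tonelli2// ge0_integral_distribution//; last 2 first.
- exact: measurable_fun_fubini_tonelli_G.
- by move=> y; exact: integral_ge0.
apply: eq_integral => t _; rewrite /= /fubini_G.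
by rewrite ge0_integral_distribution//; exact: measurable_fun_pair1.
Qed.

(** Each side integrates f against the scaled pushforward of a restricted probability, and the
    hypothesis says that these two measures agree. The constants carry cross-multiplied normalisers,
    so nothing is divided in the extended reals. *)
Lemma eq_restricted_law_integral d d' e (T : measurableType d) (T' : measurableType d')
    (S : measurableType e) (R : realType) (P : probability T R) (P' : probability T' R)
    (W : T -> S) (W' : T' -> S) (Z : set T) (Z' : set T') (c c' : {nonneg R})
    (f : S -> \bar R) :
  measurable_fun setT W -> measurable_fun setT W' -> measurable Z -> measurable Z' ->
  (forall A, measurable A ->
    (c%:num%:E * P (W @^-1` A `&` Z) = c'%:num%:E * P' (W' @^-1` A `&` Z'))%E) ->
  measurable_fun setT f -> (forall z, (0 <= f z)%E) ->
  (c%:num%:E * \int[P]_t (f (W t) * (\1_Z t)%:E) =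
   c'%:num%:E * \int[P']_t (f (W' t) * (\1_Z' t)%:E))%E.
Proof.
move=> mW mW' mZ mZ' PP' mf f0.
have scaleE d1 (T1 : measurableType d1) (Q : probability T1 R) (V : {mfun T1 >-> S})
    (D : set T1) (mD : measurable D) (Doo : (Q D < +oo)%E) (a : {nonneg R}) :
    (a%:num%:E * \int[Q]_t (f (V t) * (\1_D t)%:E) =
    \int[pushforward (mscale a (mfrestr mD Doo)) V]_z f z)%E.
  have mfV : measurable_fun setT (fun t => f (V t)) by exact: measurableT_comp.
  rewrite ge0_integral_pushforward//= preimage_setT ge0_integral_mscale//.
  congr (_ * _)%E.
  rewrite [RHS](@ge0_integral_density _ _ _ _ Q \1_D)//.
  by move=> A mA; rewrite integral_indic// setIC.
have ltZ d1 (T1 : measurableType d1) (Q : probability T1 R) (D : set T1) :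
    measurable D -> (Q D < +oo)%E.
  by move=> mD; rewrite -ge0_fin_numE// fin_num_measure.
pose V : {mfun T >-> S} := HB.pack W (isMeasurableFun.Build _ _ _ _ _ mW).
pose V' : {mfun T' >-> S} := HB.pack W' (isMeasurableFun.Build _ _ _ _ _ mW').
rewrite (scaleE _ _ P V Z mZ (ltZ _ _ _ _ mZ)) (scaleE _ _ P' V' Z' mZ' (ltZ _ _ _ _ mZ')).
by apply: eq_measure_integral => A mA _; exact: PP'.
Qed.

(** For any measurable E, testing f1 against [1_E w g0] and f0 against [1_E w g1] gives the same
    integral of [1_E w g0 g1] under F'. Hence F' drops out and the integrals over every E agree. The
    positive weight w makes the left integrand bounded, hence integrable, as the passage to
    almost-everywhere equality requires. *)
Lemma ae_eq_cross_density d (T : measurableType d) (R : realType)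
    (F F' : probability T R) (c c' M : R) (w f0 f1 g0 g1 : T -> R) :
  0 < c -> measurable_fun setT w -> (forall y, 0 < w y) ->
  measurable_fun setT f0 -> (forall y, 0 <= f0 y) ->
  measurable_fun setT f1 -> (forall y, 0 <= f1 y) ->
  measurable_fun setT g0 -> (forall y, 0 <= g0 y) ->
  measurable_fun setT g1 -> (forall y, 0 <= g1 y) ->
  (forall y, w y * (f1 y * g0 y) <= M) ->
  (forall k : T -> R, measurable_fun setT k -> (forall y, 0 <= k y) ->
    (c%:E * \int[F]_y (k y * f0 y)%:E = c'%:E * \int[F']_y (k y * g0 y)%:E)%E) ->
  (forall k : T -> R, measurable_fun setT k -> (forall y, 0 <= k y) ->
    (c%:E * \int[F]_y (k y * f1 y)%:E = c'%:E * \int[F']_y (k y * g1 y)%:E)%E) ->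
  \forall y \ae (F : {measure set T -> \bar R}), f1 y * g0 y = g1 y * f0 y.
Proof.
move=> c0 mw w0 mf0 f00 mf1 f10 mg0 g00 mg1 g10 wM E0 E1.
pose Fm : {measure set T -> \bar R} := F.
pose h1 y := w y * (f1 y * g0 y); pose h2 y := w y * (g1 y * f0 y).
have mh1 : measurable_fun setT (EFin \o h1).
  by apply/measurable_EFinP/measurable_funM => //; exact: measurable_funM.
have mh2 : measurable_fun setT (EFin \o h2).
  by apply/measurable_EFinP/measurable_funM => //; exact: measurable_funM.
have h1_int : Fm.-integrable setT (EFin \o h1).
  have M0 y : 0 <= w y * (f1 y * g0 y) by rewrite mulr_ge0 ?mulr_ge0// ltW.
  apply: (@le_integrable _ _ _ _ _ measurableT _ (EFin \o cst M)) => //.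
    move=> y _; rewrite /= lee_fin !ger0_norm.
    - exact: wM.
    - exact: le_trans (M0 y) (wM y).
    - exact: M0.
  exact: (@finite_measure_integrable_cst _ _ _ F setT M measurableT).
suff H E : E `<=` setT -> measurable E ->
    (\int[Fm]_(y in E) (EFin \o h1) y = \int[Fm]_(y in E) (EFin \o h2) y)%E.
  have ? : Filter (nbhs (almost_everywhere Fm)) by exact: ae_filter_ringOfSetsType.
  apply: (filterS _ (integral_ae_eq measurableT h1_int mh2 H)) => y h12.
  have := EFin_inj (h12 I).
  by apply: mulfI; rewrite gt_eqF.
move=> _ mE.
have mk g : measurable_fun setT g -> measurable_fun setT (fun y => \1_E y * (w y * g y)).
  by move=> mg; apply: measurable_funM => //; exact: measurable_funM.
have k0 g : (forall y, 0 <= g y) -> forall y, 0 <= \1_E y * (w y * g y).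
  by move=> g_ge0 y; rewrite !mulr_ge0// ltW.
have restrictE (h : T -> R) :
    (\int[Fm]_(y in E) (h y)%:E = \int[F]_y (\1_E y * h y)%:E)%E.
  rewrite integral_mkcond; apply: eq_integral => y _.
  by rewrite patchE indicE; case: (y \in E); rewrite ?mul1r ?mul0r.
rewrite !restrictE.
suff : (c%:E * \int[F]_y (\1_E y * h1 y)%:E =
        c%:E * \int[F]_y (\1_E y * h2 y)%:E)%E.
  move/(congr1 (mule c^-1%:E)).
  by rewrite !muleA -EFinM mulVf ?mul1e// lt0r_neq0.
transitivity (c%:E * \int[F]_y (\1_E y * (w y * g0 y) * f1 y)%:E)%E.
  by congr (_ * _)%E; apply: eq_integral => y _; rewrite /h1; congr EFin; ring.
transitivity (c%:E * \int[F]_y (\1_E y * (w y * g1 y) * f0 y)%:E)%E; last first.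
  by congr (_ * _)%E; apply: eq_integral => y _; rewrite /h2; congr EFin; ring.
rewrite (E1 _ (mk _ mg0) (k0 _ g00)) (E0 _ (mk _ mg1) (k0 _ g10)).
by congr (_ * _)%E; apply: eq_integral => y _; congr EFin; ring.
Qed.

(* The conditional transform E[e^(a * effect); Z > 0 | s = y]. *)
Definition copas_tilt (R : realType) (p : copas_param R) (a y : R) : R :=
  expR (a * theta p + a ^+ 2 * (tau p ^+ 2 + y ^+ 2) / 2) *
  normal_tail (gamma1 p + gamma2 p / y + a * (rho p * y)).

(** * The transform of a study on the selection event *)

Section copas.
Context d (T : measurableType d) (R : realType) (P : probability T R).
Variables (p : copas_param R) (s u eps del : {RV P >-> measurableTypeR R}).
Variable F : probability (measurableTypeR R) R.
Hypothesis hp : copas_space p.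
Hypothesis hM : copas_model p s u eps del F.

Let ms : measurable_fun setT (s : T -> R). Proof. exact: (measurable_funPT s). Qed.
Let mu : measurable_fun setT (u : T -> R). Proof. exact: (measurable_funPT u). Qed.
Let me : measurable_fun setT (eps : T -> R). Proof. exact: (measurable_funPT eps). Qed.
Let md : measurable_fun setT (del : T -> R). Proof. exact: (measurable_funPT del). Qed.

Lemma measurable_copas_effect : measurable_fun setT (copas_effect p s u eps).
Proof.
apply: measurable_funD; last exact: measurable_funM.
by apply: measurable_funD => //; exact: measurable_funM.
Qed.

Lemma measurable_copas_latent : measurable_fun setT (copas_latent p s del).
Proof.
apply: measurable_funD => //; apply: measurable_funD => //.
by apply: measurable_funM => //; exact: measurable_inv_fun.
Qed.

Lemma measurable_copas_selected : measurable [set t | 0 < copas_latent p s del t].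
Proof.
have := measurable_copas_latent measurableT (measurable_itv `]0, +oo[).
rewrite setTI; congr (measurable _); apply/seteqP.
by split => x /=; rewrite in_itv/= andbT.
Qed.

Lemma measurable_copas_tilt (q : copas_param R) a :
  measurable_fun setT (copas_tilt q a : measurableTypeR R -> R).
Proof.
have mid : measurable_fun setT (fun y : measurableTypeR R => y : R) by [].
apply: measurable_funM; apply: measurableT_comp => //.
- apply: measurable_funD => //; apply: measurable_funM => //.
  by apply: measurable_funM => //; exact: measurable_funD.
- exact: measurable_normal_tail.
- apply: measurable_funD; last first.
    by apply: measurable_funM => //; exact: measurable_funM.
  apply: measurable_funD => //; apply: measurable_funM => //.
  exact: measurable_inv_fun.
Qed.

(** Independence freezes s, then separates u from the pair (eps, del), leaving one univariate and
    one bivariate Gaussian transform. The test function k is arbitrary so that the identity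
    localises in the standard error. *)
Lemma copas_effect_mgf (a : R) (k : measurableTypeR R -> R) :
  measurable_fun setT k -> (forall y, 0 <= k y) ->
  (\int[P]_t ((expR (a * copas_effect p s u eps t) * k (s t))%:E *
     (\1_[set t | 0 < copas_latent p s del t] t)%:E) =
   \int[F]_y (k y * copas_tilt p a y)%:E)%E.
Proof.
move=> mk k0; have [sF uN edB u_ed ued_s] := hM.
have [_ rl rr] := hp.
pose S3 := (measurableTypeR R * measurableTypeR R * measurableTypeR R)%type.
pose c (y : measurableTypeR R) : R := gamma1 p + gamma2 p / y.
have mc : measurable_fun setT c.
  by apply: measurable_funD => //; apply: measurable_funM => //; exact: measurable_inv_fun.
pose f (z : S3 * measurableTypeR R) : \bar R :=
  (expR (a * (theta p + tau p * z.1.1.1 + z.2 * z.1.1.2)) * k z.2 *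
   selected (c z.2) z.1.2)%:E.
have z1 : measurable_fun setT (fun z : S3 * measurableTypeR R => z.1.1.1 : R).
  exact: (measurableT_comp measurable_fst (measurableT_comp measurable_fst measurable_fst)).
have z2 : measurable_fun setT (fun z : S3 * measurableTypeR R => z.1.1.2 : R).
  exact: (measurableT_comp measurable_snd (measurableT_comp measurable_fst measurable_fst)).
have z3 : measurable_fun setT (fun z : S3 * measurableTypeR R => z.1.2 : R).
  exact: (measurableT_comp measurable_snd measurable_fst).
have z4 : measurable_fun setT (fun z : S3 * measurableTypeR R => z.2 : R).
  exact: measurable_snd.
have mf : measurable_fun setT f.
  apply/measurable_EFinP; apply: measurable_funM; last first.
    by apply: measurable_selected => //; exact: (measurableT_comp mc).
  apply: measurable_funM; last exact: (measurableT_comp mk).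
  apply: measurableT_comp => //; apply: measurable_funM => //.
  apply: measurable_funD; last exact: measurable_funM.
  by apply: measurable_funD => //; exact: measurable_funM.
have f0 z : (0 <= f z)%E by rewrite lee_fin !mulr_ge0 ?expR_ge0.
transitivity (\int[P]_t f (u t, eps t, del t, s t))%E.
  apply: eq_integral => t _; rewrite -EFinM /f/= /copas_effect; congr (_ * _)%:E.
  rewrite /selected !indicE; congr (_ : bool)%:R.
  by apply/idP/idP; rewrite !inE /= in_itv/= andbT.
have mued : measurable_fun setT (fun t => (u t, eps t, del t) : S3).
  by apply: measurable_fun_pair => //; exact: measurable_fun_pair.
rewrite (@independent_integral _ _ _ _ _ _ _ P (fun t => (u t, eps t, del t)) s f)//.
transitivity (\int[P]_t (k (s t) * copas_tilt p a (s t))%:E)%E; last first.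
  have mkt : measurable_fun setT (fun y : measurableTypeR R => (k y * copas_tilt p a y)%:E).
    apply/measurable_EFinP; apply: measurable_funM => //.
    exact: measurable_copas_tilt.
  rewrite -(@ge0_integral_distribution _ _ _ _ _ P s
    (fun y : measurableTypeR R => (k y * copas_tilt p a y)%:E))//.
    by apply: eq_measure_integral => A mA _; exact: sF.
  by move=> y; rewrite lee_fin mulr_ge0// mulr_ge0 ?expR_ge0// ltW// normal_tail_gt0.
(* From here the standard error is a fixed real y; the Gaussian formulas hold for every y, so its
   sign is irrelevant. *)
apply: eq_integral => t _; move: (s t) => y {t}.
have med : measurable_fun setT
    (fun t => (eps t, del t) : (measurableTypeR R * measurableTypeR R)%type).
  exact: measurable_fun_pair.
pose ed : {RV P >-> (measurableTypeR R * measurableTypeR R)%type} :=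
  HB.pack (fun t => (eps t, del t) : (measurableTypeR R * measurableTypeR R)%type)
    (isMeasurableFun.Build _ _ _ _ _ med).
pose E1 (x : measurableTypeR R) : R := expR (a * tau p * x).
pose E2 (z : measurableTypeR R * measurableTypeR R) : R :=
  expR (a * y * z.1) * selected (c y) z.2.
have mE1 : measurable_fun setT E1.
  by apply: measurableT_comp => //; exact: measurable_funM.
have mE2 : measurable_fun setT E2.
  apply: measurable_funM; last exact: measurable_selected.
  by apply: measurableT_comp => //; exact: measurable_funM.
have E1_ge0 x : 0 <= E1 x by exact: expR_ge0.
have E2_ge0 z : 0 <= E2 z by rewrite mulr_ge0 ?expR_ge0.
have mE1u : measurable_fun setT (fun t => (E1 (u t))%:E).
  by apply/measurable_EFinP; exact: (measurableT_comp mE1).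
have mE2ed : measurable_fun setT (fun t => (E2 (ed t))%:E).
  by apply/measurable_EFinP; exact: (measurableT_comp mE2).
have mE12 : measurable_fun setT (fun t => (E1 (u t) * E2 (ed t))%:E).
  by under eq_fun do rewrite EFinM; exact: emeasurable_funM.
have intE1 : (\int[P]_t (E1 (u t))%:E = (expR ((a * tau p) ^+ 2 / 2))%:E)%E.
  rewrite -(@normal_prob_mgf _ (a * tau p) (distribution P u))//.
  by rewrite ge0_integral_distribution//; exact/measurable_EFinP.
have intE2 : (\int[P]_t (E2 (ed t))%:E =
    (expR ((a * y) ^+ 2 / 2) * normal_tail (c y + rho p * (a * y)))%:E)%E.
  rewrite -(@binormal_mgf _ (rho p) (a * y) (c y) (distribution P ed))//.
  rewrite (@ge0_integral_distribution _ _ _ _ _ P ed (EFin \o E2))//; exact/measurable_EFinP.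
transitivity (\int[P]_t ((expR (a * theta p) * k y)%:E *
    (E1 (u t) * E2 (ed t))%:E))%E.
  apply: eq_integral => t _; rewrite /f/= -EFinM; congr EFin.
  rewrite /E1 /E2/= !mulrDr !expRD !mulrA; ring.
rewrite ge0_integralZl//; last 2 first.
- by move=> t _; rewrite lee_fin mulr_ge0.
- by rewrite lee_fin mulr_ge0 ?expR_ge0.
pose g (z : measurableTypeR R * (measurableTypeR R * measurableTypeR R)) :=
  (E1 z.1 * E2 z.2)%:E.
rewrite (@independent_integral _ _ _ _ _ _ _ P u ed g)//; last 2 first.
- apply/measurable_EFinP; apply: measurable_funM.
    exact: (measurableT_comp mE1 measurable_fst).
  exact: (measurableT_comp mE2 measurable_snd).
- by move=> z; rewrite lee_fin mulr_ge0.
transitivity ((expR (a * theta p) * k y)%:E *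
    \int[P]_t ((expR ((a * tau p) ^+ 2 / 2))%:E * (E2 (ed t))%:E))%E.
  congr (_ * _)%E; apply: eq_integral => t _; rewrite -intE1 muleC.
  rewrite -ge0_integralZl//; last 2 first.
  - by move=> t' _; rewrite lee_fin.
  - by rewrite lee_fin.
  by apply: eq_integral => t' _; rewrite /g/= EFinM muleC.
rewrite ge0_integralZl//; last by move=> t _; rewrite lee_fin.
rewrite intE2 -!EFinM; congr EFin; rewrite /copas_tilt -/(c y).
rewrite (_ : a * (rho p * y) = rho p * (a * y)); last ring.
rewrite (_ : a * theta p + a ^+ 2 * (tau p ^+ 2 + y ^+ 2) / 2 =
  a * theta p + (a * tau p) ^+ 2 / 2 + (a * y) ^+ 2 / 2); last by field.
by rewrite !expRD; ring.
Qed.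

(** At a = 0 and k = 1 the transform expresses this probability as the F-integral of a strictly
    positive function. Were it zero, the whole line would be F-null. *)
Lemma copas_selected_gt0 : 0 < fine (P [set t | 0 < copas_latent p s del t]).
Proof.
have mZ := measurable_copas_selected.
have tilt_gt0 y : 0 < copas_tilt p 0 y.
  by rewrite mulr_gt0 ?expR_gt0// normal_tail_gt0.
rewrite lt0r fine_ge0// andbT fine_eq0 ?fin_num_measure//.
apply/negP => /eqP PZ0.
have := @copas_effect_mgf 0 (cst 1) (measurable_cst _) (fun _ => ler01).
under eq_integral do rewrite mul0r expR0 mulr1 mul1e.
rewrite integral_indic// setIT; under eq_integral do rewrite mul1r.
move=> int0; have {int0} : (\int[F]_y (copas_tilt p 0 y)%:E = 0)%E.
  by rewrite -int0; exact: PZ0.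
move=> int0.
have mt : measurable_fun setT (fun y : measurableTypeR R => (copas_tilt p 0 y)%:E).
  by apply/measurable_EFinP; exact: measurable_copas_tilt.
have [] := (ae_eq_integral_abs F measurableT mt).1.
  rewrite -[RHS]int0; apply: eq_integral => y _.
  by rewrite gee0_abs// lee_fin ltW.
move=> N [mN FN0 sub].
have NT : N = setT.
  apply/seteqP; split => // y _; apply: sub => /= /(_ I) /eqP.
  by rewrite eqe gt_eqF.
rewrite NT in FN0.
by have /eqP := etrans (esym (probability_setT F)) FN0; rewrite onee_eq0.
Qed.

End copas.

(** * Identifiability of the selection model *)

Theorem lemma1 (R : realType)
    (d : measure_display) (T : measurableType d) (P : probability T R)
    (d' : measure_display) (T' : measurableType d') (P' : probability T' R)
    (p p' : copas_param R)
    (F F' : probability (measurableTypeR R) R)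
    (s u eps del : {RV P >-> measurableTypeR R})
    (s' u' eps' del' : {RV P' >-> measurableTypeR R}) :
  copas_space p -> copas_space p' -> rho p != 0 ->
  abs_cont_on_pos F -> abs_cont_on_pos F' ->
  copas_model p s u eps del F ->
  copas_model p' s' u' eps' del' F' ->
  (forall A : set (measurableTypeR R * measurableTypeR R), measurable A ->
     published_law p s u eps del A = published_law p' s' u' eps' del' A) ->
  [/\ gamma1 p = gamma1 p', gamma2 p = gamma2 p', rho p = rho p',
      tau p = tau p' & theta p = theta p'].
Proof.
move=> hp hp' rho0 [_ F_leb] _ hM hM' Epub.
set Z := [set t | 0 < copas_latent p s del t].
set Z' := [set t | 0 < copas_latent p' s' del' t].
have mZ : measurable Z by exact: measurable_copas_selected.
have mZ' : measurable Z' by exact: measurable_copas_selected.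
have PZ := copas_selected_gt0 hp hM; have PZ' := copas_selected_gt0 hp' hM'.
set c : R := fine (P Z) in PZ; set c' : R := fine (P' Z') in PZ'.
(* Each model is multiplied by the other's selection probability. The identity is between extended
   reals, since the integrals may be infinite. *)
have key a (k : measurableTypeR R -> R) : measurable_fun setT k -> (forall y, 0 <= k y) ->
    (c'%:E * \int[F]_y (k y * copas_tilt p a y)%:E =
     c%:E * \int[F']_y (k y * copas_tilt p' a y)%:E)%E.
  move=> mk k0.
  rewrite -(copas_effect_mgf hp hM)// -(copas_effect_mgf hp' hM')//.
  pose f (z : measurableTypeR R * measurableTypeR R) : \bar R :=
    (expR (a * z.1) * k z.2)%:E.
  apply: (@eq_restricted_law_integral _ _ _ _ _ _ _ P P'
    (fun t => (copas_effect p s u eps t, s t))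
    (fun t => (copas_effect p' s' u' eps' t, s' t)) Z Z'
    (NngNum (ltW PZ')) (NngNum (ltW PZ)) f) => //.
  - apply: measurable_fun_pair => //; exact: measurable_copas_effect.
  - apply: measurable_fun_pair => //; exact: measurable_copas_effect.
  - move=> A mA /=; have := Epub A mA; rewrite /published_law /cond_prob -/Z -/Z' -/c -/c'.
    have mW : measurable ((fun t => (copas_effect p s u eps t, s t)) @^-1` A).
      rewrite -[X in measurable X]setTI; apply: measurable_fun_pair => //.
      exact: measurable_copas_effect.
    have mW' : measurable ((fun t => (copas_effect p' s' u' eps' t, s' t)) @^-1` A).
      rewrite -[X in measurable X]setTI; apply: measurable_fun_pair => //.
      exact: measurable_copas_effect.
    move=> /eqP; rewrite (eqr_div _ _ (lt0r_neq0 PZ) (lt0r_neq0 PZ')) => /eqP E.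
    rewrite -[X in (_ * X = _)%E]fineK ?fin_num_measure//; last exact: measurableI.
    rewrite -[X in (_ = _ * X)%E]fineK ?fin_num_measure//; last exact: measurableI.
    by rewrite -!EFinM; congr EFin; rewrite mulrC [RHS]mulrC; exact: E.
  - apply/measurable_EFinP; apply: measurable_funM.
      by apply: measurableT_comp => //; exact: measurable_funM.
    exact: (measurableT_comp mk).
  - by move=> z; rewrite lee_fin mulr_ge0 ?expR_ge0.
(* The weight w cancels the possibly non-integrable factor e^(a^2 y^2 / 2). *)
pose w (a : R) (y : measurableTypeR R) : R := expR (- (a ^+ 2 * y ^+ 2) / 2).
have mw a : measurable_fun setT (w a).
  apply: measurableT_comp => //; apply: measurable_funM => //.
  by apply: measurableT_comp => //; exact: measurable_funM.
have mtilt q a : measurable_fun setT (copas_tilt q a : measurableTypeR R -> R).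
  exact: measurable_copas_tilt.
have tilt_ge0 q a y : 0 <= @copas_tilt R q a y.
  by rewrite mulr_ge0 ?expR_ge0// ltW// normal_tail_gt0.
pose Fm : {measure set (measurableTypeR R) -> \bar R} := F.
have aeE a : \forall y \ae Fm, copas_tilt p a y * copas_tilt p' 0 y =
    copas_tilt p' a y * copas_tilt p 0 y.
  (* The bound M is what remains of the transform at a once w has removed e^(a^2 y^2 / 2) and both
     normal tails are bounded by 1. *)
  apply: (ae_eq_cross_density (F' := F') (c := c') (c' := c)
    (M := expR (a * theta p + a ^+ 2 * tau p ^+ 2 / 2)) (w := w a)) => //;
    [by move=> y; exact: expR_gt0| |exact: key|exact: key].
  move=> y; rewrite /copas_tilt; set b := normal_tail _; set b' := normal_tail _.
  rewrite expr0n/= !mul0r addr0 expR0 mul1r mulrA mulrA -expRD.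
  have alg (x : R) : - (a ^+ 2 * x ^+ 2) / 2 +
      (a * theta p + a ^+ 2 * (tau p ^+ 2 + x ^+ 2) / 2) =
      a * theta p + a ^+ 2 * tau p ^+ 2 / 2 by field.
  rewrite alg -mulrA ler_piMr ?expR_ge0// mulr_ile1 ?normal_tail_le1//.
    by rewrite ltW// normal_tail_gt0.
  by rewrite ltW// normal_tail_gt0.
(* Only countably many tilts are used, so one null set serves them all. *)
have : \forall y \ae Fm, forall n : nat,
    (copas_tilt p n%:R y * copas_tilt p' 0 y = copas_tilt p' n%:R y * copas_tilt p 0 y) /\
    (copas_tilt p (- n%:R) y * copas_tilt p' 0 y =
      copas_tilt p' (- n%:R) y * copas_tilt p 0 y).
  apply: ae_foralln => n.
  have ? : Filter (nbhs (almost_everywhere Fm)) by exact: ae_filter_ringOfSetsType.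
  by apply: (filterS2 _ _ (aeE n%:R) (aeE (- n%:R))) => y; split.
move=> [N [mN FN0 NE]].
(* Here r = rho y, so y != 0 together with rho != 0 supplies the nonzero slope required by
   [tilt_identifiable]. *)
have tiltE y : ~ N y -> y != 0 -> [/\ theta p = theta p',
    tau p ^+ 2 + y ^+ 2 = tau p' ^+ 2 + y ^+ 2,
    gamma1 p + gamma2 p / y = gamma1 p' + gamma2 p' / y & rho p * y = rho p' * y].
  move=> Ny y0.
  apply: (tilt_identifiable (@normal_tail_gt0 R) (@normal_tail_le1 R)
    (@normal_tail_inc R) (@normal_tail_cvg1 R) (@normal_tail_chernoff R)).
    by rewrite mulf_neq0.
  have tilt0 q : copas_tilt q 0 y = normal_tail (gamma1 q + gamma2 q / y).
    by rewrite /copas_tilt expr0n /= !mul0r addr0 expR0 mul1r addr0.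
  move=> n; have := contra_notP (NE y) Ny => /(_ n).
  by rewrite /tilt -!tilt0.
(* Absolute continuity excludes atoms, so finitely many points can be added to the null set N and a
   good y still remains. *)
have F1 y : F [set y] = 0%E.
  apply: (null_content_dominatesP _ _).1 F_leb _ _ _ => //; exact: lebesgue_measure_set1.
have pick (A : set (measurableTypeR R)) : measurable A -> F A = 0%E -> exists y, ~ A y.
  move=> mA FA; apply/not_existsP => H.
  have AT : A = setT by apply/seteqP; split => y // _; exact: contrapT (H y).
  rewrite AT in FA.
  by have /eqP := etrans (esym (probability_setT F)) FA; rewrite onee_eq0.
have [y1 /not_orP[Ny1 /eqP y10]] : exists y : R, ~ (N `|` [set 0]) y.
  apply: pick; first exact: measurableU.
  exact: etrans (measureU0 mN (measurable_set1 _) (F1 _)) FN0.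
have [y2] : exists y : R, ~ (N `|` [set 0] `|` [set y1]) y.
  have mN0 : measurable (N `|` [set 0]) by exact: measurableU.
  apply: pick; first exact: measurableU.
  apply: etrans (measureU0 mN0 (measurable_set1 _) (F1 _)) _.
  exact: etrans (measureU0 mN (measurable_set1 _) (F1 _)) FN0.
move=> /not_orP[/not_orP[Ny2 /eqP y20] /eqP y21].
have [th ta g1 r1] := tiltE _ Ny1 y10.
have [_ _ g2 _] := tiltE _ Ny2 y20.
(* Subtracting the identities at y1 and y2 eliminates [gamma1], and 1 / y1 differs from 1 / y2. *)
have g2E : gamma2 p = gamma2 p'.
  apply/eqP; rewrite -subr_eq0.
  have : (gamma2 p - gamma2 p') * (y1^-1 - y2^-1) = 0.
    have := congr2 (fun x y => x - y) g1 g2; lra.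
  move/eqP; rewrite mulf_eq0 => /orP[//|].
  by rewrite (subr_eq0 y1^-1) (inj_eq (@invr_inj R)) => /eqP y12; rewrite y12 eqxx in y21.
split => //.
- by move: g1; rewrite g2E => /addIr.
- by move: r1 => /mulIf; apply.
(* Both values of [tau] are nonnegative, so their squares determine them. *)
- apply/eqP; rewrite -(@eqrXn2 _ 2)//; [|by case: hp|by case: hp'].
  by move: ta => /addIr ->.
Qed.
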